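(* Let $\varepsilon\ne 0$, $\tilde c>0$ and $\tilde\varepsilon,\alpha,\beta\in\mathbb{R}$. For $c>0$ consider the system of differential inequalities for scalar functions $u,v$ of one real variable $$(\ast)_c\qquad\begin{cases} u''-\varepsilon v'-cu+\alpha v\ge 0\\ v''-\tilde\varepsilon u'-\tilde c\,v+\beta u\ge 0.\end{cases}$$ (i) There exists $c>0$ large enough such that the system $(\ast)_c$ in the interval $(0,1)$ violates the weak Maximum Principle wMP. (ii) If, instead, $c>0$ is also fixed (arbitrarily), then there exists a nonempty open interval $I\subset(0,1)$ such that the system $(\ast)_c$ in $I$ does not satisfy wMP.
   Context: A solution of a system of differential inequalities in a bounded open interval $I$ is a pair $(u,v)$ of real functions belonging to $C^2(I)\cap C^0(\overline I)$ satisfying both inequalities at every point of $I$. The system satisfies the weak Maximum Principle (wMP) in $I$ if every solution $(u,v)$ with $u\le 0$ and $v\le 0$ on $\partial I$ satisfies $u\le 0$ and $v\le 0$ in $I$. It violates (does not satisfy) wMP in $I$ if there is a solution with $u\le 0$, $v\le 0$ on $\partial I$ for which $u$ or $v$ is positive at some point of $I$. The inclusion $I\subset(0,1)$ is not required to be strict. *)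

(* Defs.v *)
From Stdlib Require Import Reals Lra Classical.
From Coquelicot Require Import Coquelicot.
Open Scope R_scope.

(* The functions are total; at points of ]a,b[ the derivatives depend only on
   the values inside ]a,b[, and [continuous_on] takes limits within [a,b], so
   values outside [a,b] play no role. *)
Definition C2_C0 (a b : R) (u : R -> R) : Prop :=
  (forall x, a < x < b ->
     ex_derive u x /\ ex_derive (Derive u) x /\
     continuous (Derive (Derive u)) x) /\
  continuous_on (fun x => a <= x <= b) u.

(* [S u v x]: the inequalities hold for the pair (u, v) at the point x. *)
Definition diff_system : Type := (R -> R) -> (R -> R) -> R -> Prop.

Definition is_solution (S : diff_system) (a b : R) (u v : R -> R) : Prop :=
  C2_C0 a b u /\ C2_C0 a b v /\ forall x, a < x < b -> S u v x.

Definition nonpos_on_boundary (a b : R) (u : R -> R) : Prop :=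
  u a <= 0 /\ u b <= 0.

Definition wMP (S : diff_system) (a b : R) : Prop :=
  forall u v : R -> R, is_solution S a b u v ->
    nonpos_on_boundary a b u -> nonpos_on_boundary a b v ->
    forall x, a < x < b -> u x <= 0 /\ v x <= 0.

Definition violates_wMP (S : diff_system) (a b : R) : Prop :=
  exists u v : R -> R, is_solution S a b u v /\
    nonpos_on_boundary a b u /\ nonpos_on_boundary a b v /\
    exists x, a < x < b /\ (0 < u x \/ 0 < v x).

Lemma violates_wMP_iff (S : diff_system) (a b : R) :
  violates_wMP S a b <-> ~ wMP S a b.
Proof.
split.
- intros (u & v & Hs & Hu & Hv & x & Hx & Hpos) H.
  destruct (H u v Hs Hu Hv x Hx); lra.
- intros H; apply NNPP; intros Hn; apply H.
  intros u v Hs Hu Hv x Hx.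
  split; apply Rnot_lt_le; intros Hpos; apply Hn;
    exists u, v; repeat (split; [assumption|]); exists x; tauto.
Qed.

Definition coupled_system (eps teps c tc alpha beta : R) : diff_system :=
  fun u v x =>
    Derive (Derive u) x - eps * Derive v x - c * u x + alpha * v x >= 0 /\
    Derive (Derive v) x - teps * Derive u x - tc * v x + beta * u x >= 0.

(* Main.v *)
Require Import Defs.
From Stdlib Require Import Reals Lra Psatz.
From Coquelicot Require Import Coquelicot.
Open Scope R_scope.

(** Both violations are explicit polynomials.  Take [v] to be a convex parabola
    that vanishes at the two endpoints.  The inequality for [v] then has the
    slack [v'' = 1] (and [- tc * v >= 0]), so it survives every [u] that is
    small together with [u'].  In the inequality for [u], the coupling term
    [- eps * v'] is positive on one half of the interval and lets [u] be
    positive there; the sign of [eps] decides which half.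

    When [c] is large and the interval is [(0,1)], the inequality for
    [u = phi / c] with [phi] fixed is nearly the pointwise bound
    [phi <= alpha * v - eps * v'], whose right side is [|eps| / 2 > 0] at one
    endpoint.  A parabola [phi] that starts from [0] there, first increases,
    and then drops steeply enough to stay strictly below this bound does the
    job (lemma [violation_large_c]).

    When [c] is given and the interval has half-length [h], solving
    [u'' = eps * v'] with zero boundary values gives a cubic of size [h^3],
    odd about the midpoint and positive on one half.  The terms [c * u] and
    [alpha * v] are of size at most [h^2], while [eps * v'] is of size [h], so
    adding to [u] a nonpositive convex parabola of size [h^4] pays for them,
    and the cubic still dominates for small [h] (lemma
    [violation_small_interval]). *)

(** Reduces a violation to first and second derivatives given in closed form,
    in place of the iterated [Derive] of the definitions. *)
Lemma violates_wMP_of_derivatives (eps teps c tc alpha beta a b : R)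
  (u u1 u2 v v1 v2 : R -> R) :
  (forall x, is_derive u x (u1 x)) -> (forall x, is_derive u1 x (u2 x)) ->
  (forall x, continuous u2 x) ->
  (forall x, is_derive v x (v1 x)) -> (forall x, is_derive v1 x (v2 x)) ->
  (forall x, continuous v2 x) ->
  (forall x, a < x < b ->
     u2 x - eps * v1 x - c * u x + alpha * v x >= 0 /\
     v2 x - teps * u1 x - tc * v x + beta * u x >= 0) ->
  nonpos_on_boundary a b u -> nonpos_on_boundary a b v ->
  (exists x, a < x < b /\ 0 < u x) ->
  violates_wMP (coupled_system eps teps c tc alpha beta) a b.
Proof.
assert (HD : forall f f1 f2 : R -> R,
  (forall x, is_derive f x (f1 x)) -> (forall x, is_derive f1 x (f2 x)) ->
  (forall x, Derive f x = f1 x) /\ (forall x, Derive (Derive f) x = f2 x)).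
{ intros f f1 f2 H1 H2.
  assert (E : forall x, Derive f x = f1 x)
    by (intros x; apply is_derive_unique, H1).
  split; [exact E|]; intros x.
  rewrite (Derive_ext _ _ x E); apply is_derive_unique, H2. }
assert (HC : forall f f1 f2 : R -> R,
  (forall x, is_derive f x (f1 x)) -> (forall x, is_derive f1 x (f2 x)) ->
  (forall x, continuous f2 x) -> C2_C0 a b f).
{ intros f f1 f2 H1 H2 H3.
  destruct (HD f f1 f2 H1 H2) as [E1 E2].
  split.
  - intros x _; repeat split.
    + exists (f1 x); apply H1.
    + exists (f2 x); apply (is_derive_ext f1); [|apply H2].
      intros t; symmetry; apply E1.
    + apply (continuous_ext f2); [|apply H3].
      intros t; symmetry; apply E2.
  - apply continuous_on_forall; intros x _.
    apply (ex_derive_continuous (V := R_NormedModule)).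
    exists (f1 x); apply H1. }
intros Hu1 Hu2 Hu3 Hv1 Hv2 Hv3 Hs Hu Hv (x0 & Hx0 & Hpos).
destruct (HD u u1 u2 Hu1 Hu2) as [Eu1 Eu2].
destruct (HD v v1 v2 Hv1 Hv2) as [Ev1 Ev2].
exists u, v; split; [split; [|split]|split; [exact Hu|split; [exact Hv|]]].
- exact (HC u u1 u2 Hu1 Hu2 Hu3).
- exact (HC v v1 v2 Hv1 Hv2 Hv3).
- intros x Hx; unfold coupled_system.
  rewrite Eu1, Eu2, Ev1, Ev2; exact (Hs x Hx).
- exists x0; split; [exact Hx0|now left].
Qed.

Lemma sign_decomposition (x : R) :
  exists s, s * s = 1 /\ (s = 1 \/ s = -1) /\ x = s * Rabs x.
Proof.
unfold Rabs; destruct (Rcase_abs x) as [H|H].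
- exists (-1); repeat split; [lra|now right|lra].
- exists 1; repeat split; [lra|now left|lra].
Qed.

Lemma Rmult_le_abs_bound (x y B : R) :
  - B <= y <= B -> - (Rabs x * B) <= x * y <= Rabs x * B.
Proof.
intros Hy; unfold Rabs; destruct (Rcase_abs x); nra.
Qed.

(** Here [u] tends to [0] with its derivatives as [c] grows, so no boundary
    layer is needed: the strict bound on [phi] leaves room for [phi'' / c]. *)
Lemma violation_large_c (eps teps tc alpha beta : R) :
  eps <> 0 -> 0 < tc ->
  exists c : R, 0 < c /\
    violates_wMP (coupled_system eps teps c tc alpha beta) 0 1.
Proof.
intros heps htc.
destruct (sign_decomposition eps) as (s & Hss & Hs & Heps).
assert (He : 0 < Rabs eps) by now apply Rabs_pos_lt.
set (e := Rabs eps) in *; clearbody e.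
set (P := 1 + e + alpha / 2).
(* With [phi y = y - M * y^2], where [y] is the distance to the endpoint where
   [- eps * v' > 0], the bound [phi < alpha * v - eps * v'] reads
   [P * y - (M + alpha / 2) * y^2 < e / 2].  As [P * y - (P^2 / e) * y^2] is at
   most [e / 4], this [M] leaves the margin [e / 4]; the last two summands
   outweigh [alpha / 2] and ensure [phi 1 <= 0]. *)
set (M := P * P / e + Rabs alpha + 1).
assert (HM : 0 <= P * P / e).
{ apply Rmult_le_pos; [apply Rle_0_sqr|left; now apply Rinv_0_lt_compat]. }
assert (HQ : forall y, P * y - P * P / e * (y * y) <= e / 4).
{ intros y.
  assert (E : e / 4 - (P * y - P * P / e * (y * y))
              = (P * y - e / 2) * (P * y - e / 2) * / e) by (field; lra).
  assert (0 < / e) by now apply Rinv_0_lt_compat.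
  assert (Hsq := Rle_0_sqr (P * y - e / 2)); unfold Rsqr in Hsq.
  assert (0 <= (P * y - e / 2) * (P * y - e / 2) * / e)
    by (apply Rmult_le_pos; lra).
  lra. }
assert (Ha : - Rabs alpha <= alpha <= Rabs alpha)
  by (unfold Rabs; destruct (Rcase_abs alpha); lra).
assert (HM0 : 1 <= M)
  by (unfold M; assert (H := Rabs_pos alpha); lra).
assert (Hphi : forall y,
  e / 4 <= - (e * (y - 1 / 2)) - (y - M * (y * y)) + alpha * (y * (y - 1) / 2)).
{ intros y; specialize (HQ y).
  assert (Hy := Rle_0_sqr y); unfold Rsqr in Hy.
  assert (0 <= (Rabs alpha + alpha / 2 + 1) * (y * y))
    by (apply Rmult_le_pos; lra).
  unfold M; unfold P at 1 in HQ; lra. }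
clearbody M; clear P HM HQ Ha.
set (T := Rabs teps * (1 + 2 * M) + Rabs beta * (1 + M)).
assert (HT : 0 <= T).
{ unfold T; assert (H1 := Rabs_pos teps); assert (H2 := Rabs_pos beta); nra. }
(* [8 * M / e] brings [phi'' / c] below the margin, and [T] bounds the numerator
   of the terms with [u] and [u'] in the inequality for [v]. *)
set (c := 8 * M / e + T + 1).
assert (HMe : 0 <= 8 * M / e).
{ apply Rmult_le_pos; [nra|left; now apply Rinv_0_lt_compat]. }
assert (Hc : 0 < c) by (unfold c; lra).
assert (HcM : 2 * M / c <= e / 4).
{ apply Rle_div_l; [exact Hc|].
  assert (e / 4 * (8 * M / e) = 2 * M) by (field; lra).
  unfold c; nra. }
assert (Hinv : 0 < / c) by now apply Rinv_0_lt_compat.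
assert (HcT : T / c <= 1) by (apply Rle_div_l; [exact Hc|unfold c; lra]).
exists c; split; [exact Hc|].
set (y := fun x : R => 1 / 2 + s * (x - 1 / 2)).
apply (violates_wMP_of_derivatives eps teps c tc alpha beta 0 1
  (fun x => (y x - M * (y x * y x)) / c)
  (fun x => s * (1 - 2 * M * y x) / c)
  (fun _ => - (2 * M) / c)
  (fun x => x * (x - 1) / 2) (fun x => x - 1 / 2) (fun _ => 1)).
- intros x; unfold y; auto_derive; [exact I|field; lra].
- intros x; unfold y; auto_derive; [exact I|].
  replace (- (2 * M) / c) with (- (2 * M) * (s * s) / c)
    by (rewrite Hss; field; lra).
  field; lra.
- intros x; apply continuous_const.
- intros x; auto_derive; [exact I|field].
- intros x; auto_derive; [exact I|ring].
- intros x; apply continuous_const.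
- intros x Hx.
  assert (Hy : 0 < y x < 1) by (unfold y; destruct Hs; subst s; lra).
  assert (Ex : x * (x - 1) = y x * (y x - 1))
    by (unfold y; destruct Hs; subst s; field).
  assert (Ed : eps * (x - 1 / 2) = e * (y x - 1 / 2))
    by (rewrite Heps; unfold y; ring).
  rewrite Ed, Ex; clear Ed Ex.
  set (z := y x) in *; clearbody z.
  split.
  + replace (c * ((z - M * (z * z)) / c)) with (z - M * (z * z))
      by (field; lra).
    specialize (Hphi z).
    replace (- (2 * M) / c) with (- (2 * M / c)) by (field; lra).
    lra.
  + assert (H1 : - (1 + 2 * M) <= s * (1 - 2 * M * z) <= 1 + 2 * M)
      by (destruct Hs; subst s; nra).
    assert (H2 : - (1 + M) <= z - M * (z * z) <= 1 + M) by nra.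
    apply (Rmult_le_abs_bound teps) in H1.
    apply (Rmult_le_abs_bound beta) in H2.
    assert (H3 : - T <= - (teps * (s * (1 - 2 * M * z)))
                        + beta * (z - M * (z * z))) by (unfold T; lra).
    apply (Rmult_le_compat_r (/ c)) in H3; [|lra].
    assert (0 <= tc * (z * (1 - z))) by (apply Rmult_le_pos; nra).
    unfold Rdiv in *; nra.
- assert (H1 : (1 - M) / c <= 0) by (unfold Rdiv; nra).
  unfold nonpos_on_boundary, y.
  destruct Hs; subst s; split; unfold Rdiv in *; nra.
- unfold nonpos_on_boundary; lra.
- (* [w] is the vertex of [phi]. *)
  assert (Hw : 0 < / (2 * M)) by (apply Rinv_0_lt_compat; lra).
  assert (Hw1 : M * / (2 * M) = 1 / 2) by (field; lra).
  set (w := / (2 * M)) in *; clearbody w.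
  exists (1 / 2 + s * (w - 1 / 2)); split.
  + assert (w <= 1 / 2) by nra. destruct Hs; subst s; lra.
  + assert (E : y (1 / 2 + s * (w - 1 / 2)) = w)
      by (unfold y; destruct Hs; subst s; ring).
    rewrite E; apply Rmult_lt_0_compat; nra.
Qed.

(** As [h] tends to [0], [c * u] and [alpha * v] vanish relative to [eps * v'],
    and the terms with [u] and [u'] in the inequality for [v] vanish relative to
    [v'' = 1]: the coupling by [eps] alone drives the violation. *)
Lemma violation_small_interval (eps teps c tc alpha beta : R) :
  eps <> 0 -> 0 < tc -> 0 < c ->
  exists a b : R, 0 <= a /\ a < b /\ b <= 1 /\
    violates_wMP (coupled_system eps teps c tc alpha beta) a b.
Proof.
intros heps htc hc.
destruct (sign_decomposition eps) as (s & Hss & Hs & Heps).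
assert (He : 0 < Rabs eps) by now apply Rabs_pos_lt.
set (e := Rabs eps) in *; clearbody e.
assert (Ha : - Rabs alpha <= alpha <= Rabs alpha)
  by (unfold Rabs; destruct (Rcase_abs alpha); lra).
set (A := Rabs alpha / 2 + 1).
assert (HA : 1 <= A) by (unfold A; assert (H := Rabs_pos alpha); lra).
assert (Ht := Rabs_pos teps). assert (Hb := Rabs_pos beta).
(* The correction to the cubic is [A * h^2 * (z^2 - h^2) / 2] with
   [z = x - h], and [h = 1 / K].  In [K], the summand [D] makes [c * u] and the
   terms with [u] and [u'] in the inequality for [v] small, [2] fits the
   interval into [(0,1)], and [6 * (A / e)] makes the cubic dominate. *)
set (D := c * e + (Rabs teps + Rabs beta) * (e + A)).
assert (HD1 : c * e <= D) by (unfold D; nra).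
assert (HD2 : (Rabs teps + Rabs beta) * (e + A) <= D) by (unfold D; nra).
clearbody D.
assert (HAe : 0 < A / e) by (apply Rdiv_lt_0_compat; lra).
set (K := D + 2 + 6 * (A / e)).
assert (HK : 2 < K) by (unfold K; nra).
set (h := / K).
assert (Hh : 0 < h) by (apply Rinv_0_lt_compat; lra).
assert (HhK : h * K = 1) by (unfold h; field; lra).
clearbody h.
assert (Hh2 : 2 * h < 1) by nra.
assert (HhD : h * D <= 1) by (unfold K in HhK; nra).
assert (HhA : 6 * A * h < e).
{ assert (E : e = h * K * e) by (rewrite HhK; ring).
  assert (E' : h * K * e = h * (D + 2) * e + 6 * A * h)
    by (unfold K; field; lra).
  assert (0 < h * (D + 2) * e) by (repeat apply Rmult_lt_0_compat; nra).
  lra. }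
exists 0, (2 * h); repeat split; try lra.
(* [u] is the cubic plus its correction, with the factor [z^2 - h^2] taken out. *)
apply (violates_wMP_of_derivatives eps teps c tc alpha beta 0 (2 * h)
  (fun x => ((x - h) * (x - h) - h * h) * (eps * (x - h) / 6 + A * (h * h) / 2))
  (fun x => eps * (3 * ((x - h) * (x - h)) - h * h) / 6
            + A * (h * h) * (x - h))
  (fun x => eps * (x - h) + A * (h * h))
  (fun x => ((x - h) * (x - h) - h * h) / 2) (fun x => x - h) (fun _ => 1)).
- intros x; auto_derive; [exact I|field].
- intros x; auto_derive; [exact I|field].
- intros x; apply (ex_derive_continuous (V := R_NormedModule)).
  auto_derive; exact I.
- intros x; auto_derive; [exact I|field].
- intros x; auto_derive; [exact I|ring].
- intros x; apply continuous_const.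
- intros x Hx.
  assert (Hz : - h < x - h < h) by lra.
  set (z := x - h) in *; clearbody z; clear x Hx.
  set (q := h * h - z * z).
  assert (Hq : 0 <= q <= h * h) by (unfold q; nra).
  replace (z * z - h * h) with (- q) by (unfold q; ring).
  assert (Hez : - (e * h) <= eps * z <= e * h)
    by (rewrite Heps; destruct Hs; subst s; nra).
  split.
  + assert (H1 : c * (- q * (eps * z / 6)) <= h * h).
    { assert (- q * (eps * z) <= h * h * (e * h)) by nra.
      assert (c * (e * h) <= 1) by nra.
      nra. }
    assert (Hhh : 0 <= A * (h * h)) by nra.
    assert (H2 : 0 <= c * (q * (A * (h * h)))).
    { apply Rmult_le_pos; [lra|apply Rmult_le_pos; lra]. }
    assert (H3 : alpha * q <= Rabs alpha * (h * h)) by nra.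
    assert (EA : A * (h * h) = Rabs alpha * (h * h) / 2 + h * h)
      by (unfold A; field).
    lra.
  + assert (Hhh : h * h <= h) by nra.
    assert (Hhhh : h * h * h <= h) by nra.
    assert (H1 : - ((e + A) * h) <= eps * (3 * (z * z) - h * h) / 6
                   + A * (h * h) * z <= (e + A) * h).
    { assert (- (e * h) <= eps * (3 * (z * z) - h * h) / 6 <= e * h).
      { assert (- (h * h) <= 3 * (z * z) - h * h <= 2 * (h * h)) by nra.
        rewrite Heps; destruct Hs; subst s; nra. }
      assert (- (h * h * h) <= h * h * z <= h * h * h) by nra.
      nra. }
    assert (H2 : - ((e + A) * h)
                 <= - q * (eps * z / 6 + A * (h * h) / 2) <= (e + A) * h).
    { set (g := eps * z / 6 + A * (h * h) / 2).
      assert (- (e + A) <= g <= e + A) by (unfold g; nra).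
      clearbody g; nra. }
    apply (Rmult_le_abs_bound teps) in H1.
    apply (Rmult_le_abs_bound beta) in H2.
    assert (0 <= tc * q) by (apply Rmult_le_pos; lra).
    nra.
- unfold nonpos_on_boundary; split; apply Req_le; field.
- unfold nonpos_on_boundary; split; apply Req_le; field.
- (* The middle of the half on which the cubic is positive. *)
  exists (h - s * (h / 2)); split.
  + destruct Hs; subst s; lra.
  + replace (h - s * (h / 2) - h) with (- s * (h / 2)) by ring.
    replace (- s * (h / 2) * (- s * (h / 2))) with (s * s * (h * h) / 4) by field.
    replace (eps * (- s * (h / 2)) / 6) with (- (s * s * e * h) / 12)
      by (rewrite Heps; field).
    rewrite Hss.
    assert (0 < h * (e - 6 * A * h)) by (apply Rmult_lt_0_compat; lra).
    assert (0 < h * h) by nra.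
    nra.
Qed.

Theorem proposition2 (eps teps tc alpha beta : R)
  (heps : eps <> 0) (htc : 0 < tc) :
  (exists c : R, 0 < c /\
     violates_wMP (coupled_system eps teps c tc alpha beta) 0 1)
  /\
  (forall c : R, 0 < c ->
     exists a b : R, 0 <= a /\ a < b /\ b <= 1 /\
       violates_wMP (coupled_system eps teps c tc alpha beta) a b).
Proof.
split.
- now apply violation_large_c.
- intros c hc; now apply violation_small_interval.
Qed.
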